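(* Let $\varphi_0,\ldots,\varphi_{p+q}\colon\mathbb{R}^n\to\overline{\mathbb{R}}$, $I=\{1,\ldots,p\}$, $J=\{p+1,\ldots,p+q\}$, and consider the problem $$\min\{\varphi_0(z)\mid \varphi_i(z)\le 0\ (i\in I),\ \varphi_i(z)=0\ (i\in J)\}.$$ Let $\bar z$ be a feasible point of this problem such that $\varphi_0,\ldots,\varphi_{p+q}$ are locally Lipschitz continuous in a neighborhood of $\bar z$. If $\bar z$ is a local minimizer of the problem, then $\bar z$ is an asymptotically $\partial$-stationary (A$\partial$-stationary) point of the problem.
   Context: $\overline{\mathbb{R}}=\mathbb{R}\cup\{-\infty,\infty\}$. For a closed set $A\subset\mathbb{R}^n$ and $\bar z\in A$, the regular normal cone is $\widehat{\mathcal N}_A(\bar z)=\{\xi\mid \forall z\in A:\ \xi^\top(z-\bar z)\le o(\|z-\bar z\|)\}$ and the limiting normal cone is $\mathcal N_A(\bar z)=\limsup_{z\to\bar z,\,z\in A}\widehat{\mathcal N}_A(z)$, i.e. the set of all limits of sequences $\xi^k\in\widehat{\mathcal N}_A(z^k)$ with $z^k\in A$, $z^k\to\bar z$. For a function $\psi$ that is locally Lipschitz continuous at $\bar z$, the limiting (Mordukhovich) subdifferential is $\partial\psi(\bar z)=\{\xi\mid(\xi,-1)\in\mathcal N_{\operatorname{epi}\psi}(\bar z,\psi(\bar z))\}$. Subdifferentials are only considered at points near which the function is Lipschitz continuous. A feasible point $\bar z$ is called A$\partial$-stationary if there are sequences $\{z^k\},\{\varepsilon^k\}\subset\mathbb{R}^n$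 and $\{\lambda^k\}\subset\mathbb{R}^{p+q}$ with $z^k\to\bar z$, $\varepsilon^k\to0$ and, for all $k\in\mathbb{N}$, $$\varepsilon^k\in\partial\varphi_0(z^k)+\sum_{i\in I}\lambda_i^k\,\partial\varphi_i(z^k)+\sum_{i\in J}\lambda_i^k\bigl(\partial\varphi_i(z^k)\cup\partial(-\varphi_i)(z^k)\bigr),$$ $\min(\lambda_i^k,-\varphi_i(\bar z))=0$ for all $i\in I$, and $\lambda_i^k\ge0$ for all $i\in J$. (Sums of sets are Minkowski sums.) *)

(* Defs.v *)
From mathcomp Require Export all_boot all_order all_algebra.
From mathcomp Require Export all_classical all_reals all_analysis.
Export Order.TTheory GRing.Theory Num.Theory.
Export numFieldNormedType.Exports.

Set Implicit Arguments.
Unset Strict Implicit.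
Unset Printing Implicit Defensive.

Local Open Scope classical_set_scope.
Local Open Scope ring_scope.

Definition dot (R : realType) (m : nat) (x y : 'rV[R]_m) : R :=
  (x *m y^T) 0 0.

(* The one-sided o(|z - zb|) bound, spelled out.  The norm is the library's
   sup norm on 'rV[R]_m; as all norms on R^m are equivalent, the o(.) does not
   depend on this choice. *)
Definition regular_normal_cone (R : realType) (m : nat)
    (A : set 'rV[R]_m) (zb : 'rV[R]_m) : set 'rV[R]_m :=
  [set xi | forall e : R, 0 < e ->
    \forall z \near zb, A z -> dot xi (z - zb) <= e * `|z - zb|].

Definition limiting_normal_cone (R : realType) (m : nat)
    (A : set 'rV[R]_m) (zb : 'rV[R]_m) : set 'rV[R]_m :=
  [set xi | exists (z x : nat -> 'rV[R]_m),
    [/\ forall k, A (z k),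
        forall k, regular_normal_cone A (z k) (x k),
        z @ \oo --> zb
      & x @ \oo --> xi]].

Definition epigraph (R : realType) (n : nat) (psi : 'rV[R]_n -> \bar R) :
    set 'rV[R]_(n + 1) :=
  [set w | (psi (lsubmx w) <= (rsubmx w 0 0)%:E)%E].

Definition lipschitz_near (R : realType) (n : nat)
    (psi : 'rV[R]_n -> \bar R) (z : 'rV[R]_n) : Prop :=
  exists U : set 'rV[R]_n,
    [/\ nbhs z U,
        forall x, U x -> psi x \is a fin_num
      & [lipschitz fine (psi x) | x in U]].

(* The subdifferential is only defined at points near which psi is Lipschitz;
   at all other points it is set to be empty, so that membership entails that
   it is considered at an admissible point. *)
Definition subdifferential (R : realType) (n : nat)
    (psi : 'rV[R]_n -> \bar R) (z : 'rV[R]_n) : set 'rV[R]_n :=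
  [set xi | lipschitz_near psi z /\
    limiting_normal_cone (epigraph psi)
      (row_mx z (const_mx (fine (psi z)))) (row_mx xi (const_mx (-1)))].

Definition minkowski_add (R : realType) (n : nat) (A B : set 'rV[R]_n) :
    set 'rV[R]_n :=
  [set a + b | a in A & b in B].

Definition scale_set (R : realType) (n : nat) (l : R) (A : set 'rV[R]_n) :
    set 'rV[R]_n :=
  [set l *: a | a in A].

(* The constraints are indexed from 0: I is {i | i < p} and J is
   {i | p <= i} in 'I_(p + q). *)
Definition feasible (R : realType) (n p q : nat)
    (phi : 'I_(p + q) -> 'rV[R]_n -> \bar R) : set 'rV[R]_n :=
  [set z | (forall i : 'I_(p + q), (i < p)%N -> (phi i z <= 0)%E) /\
           (forall i : 'I_(p + q), (p <= i)%N -> phi i z = 0%E)].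

Definition local_minimizer (R : realType) (n p q : nat)
    (phi0 : 'rV[R]_n -> \bar R) (phi : 'I_(p + q) -> 'rV[R]_n -> \bar R)
    (zb : 'rV[R]_n) : Prop :=
  feasible phi zb /\
  \forall z \near zb, feasible phi z -> (phi0 zb <= phi0 z)%E.

Definition stationarity_set (R : realType) (n p q : nat)
    (phi0 : 'rV[R]_n -> \bar R) (phi : 'I_(p + q) -> 'rV[R]_n -> \bar R)
    (z : 'rV[R]_n) (lam : 'rV[R]_(p + q)) : set 'rV[R]_n :=
  minkowski_add
    (minkowski_add
      (subdifferential phi0 z)
      (\big[@minkowski_add R n/[set 0]]_(i < p + q | (i < p)%N)
         scale_set (lam 0 i) (subdifferential (phi i) z)))
    (\big[@minkowski_add R n/[set 0]]_(i < p + q | (p <= i)%N)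
       scale_set (lam 0 i)
         (subdifferential (phi i) z `|`
          subdifferential (fun x => (- phi i x)%E) z)).

Definition asymptotically_stationary (R : realType) (n p q : nat)
    (phi0 : 'rV[R]_n -> \bar R) (phi : 'I_(p + q) -> 'rV[R]_n -> \bar R)
    (zb : 'rV[R]_n) : Prop :=
  feasible phi zb /\
  exists (z eps : nat -> 'rV[R]_n) (lam : nat -> 'rV[R]_(p + q)),
    [/\ z @ \oo --> zb,
        eps @ \oo --> (0 : 'rV[R]_n)
      & forall k : nat,
        [/\ stationarity_set phi0 phi (z k) (lam k) (eps k),
            forall i : 'I_(p + q), (i < p)%N ->
              Order.min (lam k 0 i)%:E (- phi i zb)%E = 0%E
          & forall i : 'I_(p + q), (p <= i)%N -> 0 <= lam k 0 i]].

(* Main.v *)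
Require Import Defs.
From mathcomp Require Import ring lra.

(** Near a local minimizer [zb], minimize over a compact neighbourhood the
    penalty function [phi0 + k * (sum of squared violations) + |. - zb|^2].  Its
    minimizers accumulate at [zb] ([penalty_minimizers]).  At such a minimizer
    [z] the squared violations are bounded above by their linearizations in the
    constraint functions, up to a quadratic in the distance to [z]; hence [z]
    minimizes a weighted sum of [phi0] and of the functions [phi i] or
    [- phi i], plus smooth terms.  The weights are [2 k] times the absolute
    violations at [z]: they are nonnegative, and vanish on inactive constraints
    once [z] is close to [zb].  The remaining gradient, [2 (z - zb)] up to sign,
    is the error term ([penalty_stationary]).

    What is needed is then a sum rule placing limiting subgradients of all the
    functions at the same point [z] ([weighted_sum_rule]).  For a minimizer of
    a weighted sum of Lipschitz functions it is obtained by replacing all the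
    functions but one by their Moreau envelopes with parameter [j].  The
    regularized problem has a minimizer near [z], and the optimality of the
    proximal points yields regular subgradients, at nearby points, whose
    weighted sum balances the gradient of the smooth terms exactly
    ([approximate_sum_rule]).  They are bounded by the Lipschitz constant, so
    they converge along an ultrafilter as [j] tends to infinity.  Finally, a
    limit of regular subgradients at nearby points is a limiting normal to the
    epigraph ([limiting_subgradient_subdifferential]). *)

Set Implicit Arguments.
Unset Strict Implicit.
Unset Printing Implicit Defensive.

Local Open Scope classical_set_scope.
Local Open Scope ring_scope.

(** * Inner product and sup norm *)

Lemma dotE (R : realType) n (x y : 'rV[R]_n) :
  dot x y = \sum_j x 0 j * y 0 j.
Proof. by rewrite /dot mxE; apply: eq_bigr => j _; rewrite mxE. Qed.

Lemma dotC (R : realType) n (x y : 'rV[R]_n) : dot x y = dot y x.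
Proof. by rewrite !dotE; apply: eq_bigr => j _; rewrite mulrC. Qed.

Lemma dotDl (R : realType) n (x y z : 'rV[R]_n) :
  dot (x + y) z = dot x z + dot y z.
Proof. by rewrite /dot mulmxDl mxE. Qed.

Lemma dotZl (R : realType) n (a : R) (x y : 'rV[R]_n) :
  dot (a *: x) y = a * dot x y.
Proof. by rewrite /dot -scalemxAl mxE. Qed.

Lemma dotNl (R : realType) n (x y : 'rV[R]_n) : dot (- x) y = - dot x y.
Proof. by rewrite -scaleN1r dotZl mulN1r. Qed.

Lemma dotDr (R : realType) n (x y z : 'rV[R]_n) :
  dot z (x + y) = dot z x + dot z y.
Proof. by rewrite dotC dotDl !(dotC z). Qed.

Lemma dotNr (R : realType) n (x y : 'rV[R]_n) : dot x (- y) = - dot x y.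
Proof. by rewrite dotC dotNl dotC. Qed.

Lemma dot0r (R : realType) n (x : 'rV[R]_n) : dot x 0 = 0.
Proof. by rewrite dotE big1// => j _; rewrite mxE mulr0. Qed.

Lemma dot_suml (R : realType) n (T : finType) (F : T -> 'rV[R]_n)
    (y : 'rV[R]_n) :
  dot (\sum_i F i) y = \sum_i dot (F i) y.
Proof. by rewrite /dot mulmx_suml summxE. Qed.

Lemma dot_row_mx (R : realType) m n (a c : 'rV[R]_m) (b d : 'rV[R]_n) :
  dot (row_mx a b) (row_mx c d) = dot a c + dot b d.
Proof. by rewrite /dot tr_row_mx mul_row_col mxE. Qed.

Lemma dot_sqrD (R : realType) n (u v : 'rV[R]_n) :
  dot (u + v) (u + v) = dot u u + 2 * dot u v + dot v v.
Proof. rewrite dotDl !dotDr (dotC v u); ring. Qed.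

Lemma dot_ge0 (R : realType) n (v : 'rV[R]_n) : 0 <= dot v v.
Proof. by rewrite dotE sumr_ge0// => j _; rewrite -expr2 sqr_ge0. Qed.

Lemma norm_entry_le (R : realType) m n (x : 'M[R]_(m, n)) i j :
  `|x i j| <= `|x|.
Proof. by rewrite [leRHS]mx_normrE; exact: (le_bigmax _ _ (i, j)). Qed.

Lemma mx_norm_leP (R : realType) m n (x : 'M[R]_(m, n)) (e : R) : 0 <= e ->
  (forall i j, `|x i j| <= e) -> `|x| <= e.
Proof.
move=> e0 xe; rewrite [leLHS]mx_normrE; apply: bigmax_le => // -[i j] _.
Qed.

Lemma sqr_norm_le_dot (R : realType) n (v : 'rV[R]_n) : `|v| ^+ 2 <= dot v v.
Proof.
have [->|] := eqVneq v 0; first by rewrite normr0 expr2 mul0r dot_ge0.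
rewrite -normr_eq0 => /mx_norm_neq0[[i j]]; rewrite ord1 /= => vj.
have -> : `|v| = `|v 0 j| by [].
rewrite -normrX ger0_norm ?sqr_ge0// dotE (bigD1 j)//= -expr2 lerDl.
by rewrite sumr_ge0// => k _; rewrite -expr2 sqr_ge0.
Qed.

Lemma norm_dot_le (R : realType) n (u v : 'rV[R]_n) :
  `|dot u v| <= n%:R * (`|u| * `|v|).
Proof.
rewrite dotE (le_trans (ler_norm_sum _ _ _))//.
have -> : n%:R * (`|u| * `|v|) = \sum_(j < n) (`|u| * `|v|).
  by rewrite sumr_const card_ord mulr_natl.
by apply: ler_sum => j _; rewrite normrM ler_pM// norm_entry_le.
Qed.

Lemma norm_row_mx_lt (R : realType) m n (a : 'rV[R]_m) (b : 'rV[R]_n) (e : R) :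
  0 < e -> `|a| < e -> `|b| < e -> `|row_mx a b| < e.
Proof.
move=> e0 ae be.
have : `|row_mx a b| <= Num.max `|a| `|b|.
  apply: mx_norm_leP => [|i j]; first by rewrite le_max normr_ge0.
  rewrite mxE le_max; case: fintype.splitP => k _.
    by rewrite norm_entry_le.
  by rewrite norm_entry_le orbT.
by move=> /le_lt_trans; apply; rewrite gt_max ae be.
Qed.

Lemma norm_lsubmx_le (R : realType) m n1 n2 (w : 'M[R]_(m, n1 + n2)) :
  `|lsubmx w| <= `|w|.
Proof. by apply: mx_norm_leP => // i j; rewrite mxE norm_entry_le. Qed.

Lemma near_norm_lt (R : realType) n (x : 'rV[R]_n) (e : R) : 0 < e ->
  \forall y \near x, `|y - x| < e.
Proof.
move=> e0; near=> y; rewrite distrC; near: y.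
by apply: (@cvgr_dist_lt _ _ _ _ _ id x).
Unshelve. all: by end_near. Qed.

(** The exponent is there because a quadratic growth condition controls only the
    square of a distance. *)
Lemma cvg_nat_rate (R : realType) n (z : 'rV[R]_n) (u : nat -> 'rV[R]_n)
    (c : R) (m : nat) :
  (forall k, `|u k - z| ^+ m.+1 <= c / k.+1%:R) -> u @ \oo --> z.
Proof.
move=> uz; apply/cvgrPdist_lt => e e0.
have c0 : 0 < `|c| + 1 by rewrite ltr_pwDr.
have em : 0 < e ^+ m.+1 by rewrite exprn_gt0.
near=> k; rewrite distrC -(@ltr_pXn2r R m.+1 isT) ?nnegrE ?(ltW e0)//.
rewrite (le_lt_trans (uz k))//.
apply: (@le_lt_trans _ _ ((`|c| + 1) / k.+1%:R)).
  by rewrite ler_wpM2r ?invr_ge0// (le_trans (ler_norm _))// lerDl.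
rewrite mulrC -ltr_pdivlMr//; near: k.
exact: near_infty_natSinv_lt (PosNum (divr_gt0 em c0)).
Unshelve. all: by end_near. Qed.

(** * Subgradients of real functions and normals to epigraphs *)

(** For Lipschitz [g] this is membership of [(xi, -1)] in the regular normal
    cone of the epigraph, read on the function itself. *)
Definition regular_subgradient (R : realType) n (g : 'rV[R]_n -> R)
    (x xi : 'rV[R]_n) :=
  forall e : R, 0 < e ->
    \forall y \near x, g x + dot xi (y - x) - e * `|y - x| <= g y.

(** Stated with one tolerance rather than with sequences, so that limits taken
    along any proper filter (an ultrafilter below) yield limiting subgradients;
    sequences are recovered by countable choice in [limiting_normal_coneP]. *)
Definition limiting_subgradient (R : realType) n (g : 'rV[R]_n -> R)
    (z xi : 'rV[R]_n) :=
  forall e : R, 0 < e ->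
    exists x ze, [/\ `|x - z| < e, `|ze - xi| < e & regular_subgradient g x ze].

(** Proximal subgradients are regular: a quadratic is [o(|y - x|)].  All
    regular subgradients below come from minimization problems with quadratic
    terms, hence through this lemma. *)
Lemma regular_subgradient_quadratic (R : realType) n (g : 'rV[R]_n -> R)
    (x xi : 'rV[R]_n) (K : R) : 0 <= K ->
  (\forall y \near x, g x + dot xi (y - x) - K * dot (y - x) (y - x) <= g y) ->
  regular_subgradient g x xi.
Proof.
move=> K0 gK e e0.
(* [K * n%:R] bounds the quadratic; 1 is added to divide by a positive
   number. *)
pose M := K * n%:R + 1.
have M0 : 0 < M by rewrite ltr_pwDr// mulr_ge0.
have xe : \forall y \near x, `|y - x| < e / M.
  by apply: near_norm_lt; rewrite divr_gt0.
near=> y.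
have yx : `|y - x| < e / M by near: y.
apply: (@le_trans _ _ (g x + dot xi (y - x) - K * dot (y - x) (y - x)));
  last by near: y.
rewrite lerD2l lerN2.
have := norm_dot_le (y - x) (y - x); rewrite ger0_norm ?dot_ge0// => dle.
rewrite (le_trans (ler_wpM2l K0 dle))//.
rewrite !mulrA ler_wpM2r//.
apply: (@le_trans _ _ (M * `|y - x|)).
  by rewrite ler_wpM2r// /M lerDl.
by rewrite mulrC -ler_pdivlMr// ltW.
Unshelve. all: by end_near. Qed.

Lemma limiting_subgradient_filter (R : realType) n (g : 'rV[R]_n -> R)
    (z xi : 'rV[R]_n) (T : Type) (F : set_system T) (FF : ProperFilter F)
    (x ze : T -> 'rV[R]_n) :
  x @ F --> z -> ze @ F --> xi ->
  (\forall j \near F, regular_subgradient g (x j) (ze j)) ->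
  limiting_subgradient g z xi.
Proof.
move=> xz zexi gF e e0.
have : \forall j \near F, [/\ `|x j - z| < e, `|ze j - xi| < e &
    regular_subgradient g (x j) (ze j)].
  near=> j; split; last by near: j.
    by rewrite distrC; near: j; exact: cvgr_dist_lt.
  by rewrite distrC; near: j; exact: cvgr_dist_lt.
by move=> /filter_ex[j ?]; exists (x j), (ze j).
Unshelve. all: by end_near. Qed.

Lemma lipschitz_nearP (R : realType) n (phi : 'rV[R]_n -> \bar R)
    (z : 'rV[R]_n) :
  lipschitz_near phi z -> exists U (L : R),
    [/\ nbhs z U, 0 <= L, forall x, U x -> phi x \is a fin_num &
     forall x y, U x -> U y -> `|fine (phi x) - fine (phi y)| <= L * `|x - y|].
Proof.
move=> [U [zU Ufin Ulip]]; exists U.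
have [M [_ MU]] := Ulip.
exists (Num.max 0 (M + 1)); split => //; first by rewrite le_max lexx.
move=> x y Ux Uy.
apply: (MU _ _ (x, y)) => //=.
by rewrite lt_max ltrDl ltr01 orbT.
Qed.

(** It suffices to test points of the graph: lowering a point of the epigraph to
    the graph increases its pairing with [(xi, -1)], and the error bound
    involves only the horizontal part of a displacement, which is no longer
    than the displacement itself. *)
Lemma regular_subgradient_epi_normal (R : realType) n (phi : 'rV[R]_n -> \bar R)
    (x xi : 'rV[R]_n) : (\forall y \near x, phi y \is a fin_num) ->
  regular_subgradient (fun y => fine (phi y)) x xi ->
  regular_normal_cone (epigraph phi) (row_mx x (const_mx (fine (phi x))))
    (row_mx xi (const_mx (-1))).
Proof.
move=> phifin xsub e e0; near=> w => epiw.
have [wfin wsub] : phi (lsubmx w) \is a fin_num /\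
    fine (phi x) + dot xi (lsubmx w - x) - e * `|lsubmx w - x| <=
    fine (phi (lsubmx w)).
  near: w.
  have : \forall y \near x, phi y \is a fin_num /\
    fine (phi x) + dot xi (y - x) - e * `|y - x| <= fine (phi y).
    by near=> y; split; near: y; [exact: phifin|exact: xsub].
  move=> /nbhs_ballP[d /= d0 dP].
  apply/nbhs_ballP; exists d => //= w; rewrite -ball_normE /= => wd.
  apply: dP; rewrite -ball_normE /=; apply: le_lt_trans wd.
  rewrite (le_trans _ (norm_lsubmx_le _))//.
  by rewrite linearB/= row_mxKl.
rewrite -[w in dot _ (w - _)]hsubmxK [X in dot _ (_ + X)]opp_row_mx add_row_mx
  dot_row_mx.
have -> : dot (const_mx (-1)) (rsubmx w - const_mx (fine (phi x))) =
    fine (phi x) - rsubmx w 0 0.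
  by rewrite dotE big_ord1 !mxE mulN1r opprB.
have {}epiw : fine (phi (lsubmx w)) <= rsubmx w 0 0.
  by rewrite -lee_fin fineK.
have : `|lsubmx w - x| <= `|w - row_mx x (const_mx (fine (phi x)))|.
  by rewrite (le_trans _ (norm_lsubmx_le _))// linearB/= row_mxKl.
move=> /(ler_wpM2l (ltW e0)).
lra.
Unshelve. all: by end_near. Qed.

Lemma limiting_normal_coneP (R : realType) m (A : set 'rV[R]_m)
    (zb xi : 'rV[R]_m) :
  (forall e : R, 0 < e -> exists z x,
    [/\ A z, regular_normal_cone A z x, `|z - zb| < e & `|x - xi| < e]) ->
  limiting_normal_cone A zb xi.
Proof.
move=> H.
have /choice[z /choice[x zx]] : forall k : nat, exists z x,
    [/\ A z, regular_normal_cone A z x, `|z - zb| < k.+1%:R^-1 &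
        `|x - xi| < k.+1%:R^-1].
  by move=> k; apply: H; rewrite invr_gt0.
exists z, x; split=> [k|k||].
- by have [] := zx k.
- by have [] := zx k.
- apply: (@cvg_nat_rate _ _ _ _ 1 0) => k; rewrite expr1 div1r ltW//.
  by have [_ _ + _] := zx k.
- apply: (@cvg_nat_rate _ _ _ _ 1 0) => k; rewrite expr1 div1r ltW//.
  by have [_ _ _ +] := zx k.
Qed.

(** The points of the epigraph to which the approximating normals are attached
    are [(x, phi x)]; they converge to [(z, phi z)] because [phi] is Lipschitz,
    which is why the radius below is divided by a Lipschitz constant. *)
Lemma limiting_subgradient_subdifferential (R : realType) n
    (phi : 'rV[R]_n -> \bar R) (z xi : 'rV[R]_n) : lipschitz_near phi z ->
  limiting_subgradient (fun y => fine (phi y)) z xi -> subdifferential phi z xi.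
Proof.
move=> lipz subz; split => //.
have [U [L [zU L0 Ufin Ulip]]] := lipschitz_nearP lipz.
apply: limiting_normal_coneP => e e0.
have : \forall x \near z, nbhs x U by exact: nbhs_interior.
move=> /nbhs_ballP[d /= d0]; rewrite -ball_normE => dU.
pose M := L + 1.
have M1 : 1 <= M by rewrite lerDr.
have M0 : 0 < M by rewrite (lt_le_trans ltr01).
(* [d] keeps [x] inside [U]; [e / M] keeps both coordinates of [(x, phi x)]
   within [e]. *)
pose r := Num.min d (e / M).
have r0 : 0 < r by rewrite lt_min d0 divr_gt0.
have re : r <= e by rewrite ge_min ler_pdivrMr// ler_peMr ?orbT// ltW.
have [x [ze [xz zexi xsub]]] := subz r r0.
have nxU : nbhs x U.
  by apply: dU; rewrite /= distrC (lt_le_trans xz)// ge_min lexx.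
have Ux := nbhs_singleton nxU.
have Uz := nbhs_singleton zU.
exists (row_mx x (const_mx (fine (phi x)))), (row_mx ze (const_mx (-1))); split.
- by rewrite /epigraph /= row_mxKl row_mxKr mxE fineK// Ufin.
- apply: regular_subgradient_epi_normal => //.
  by apply: filterS nxU; exact: Ufin.
- rewrite opp_row_mx add_row_mx norm_row_mx_lt//; first exact: lt_le_trans xz _.
  apply: (@le_lt_trans _ _ `|fine (phi x) - fine (phi z)|).
    by apply: mx_norm_leP => // i j; rewrite !mxE.
  apply: le_lt_trans (Ulip _ _ Ux Uz) _.
  have : M * `|x - z| < e.
    by rewrite mulrC -ltr_pdivlMr// (lt_le_trans xz)// ge_min lexx orbT.
  by apply: le_lt_trans; rewrite ler_wpM2r// lerDl.
- rewrite opp_row_mx add_row_mx subrr norm_row_mx_lt ?normr0//.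
  exact: lt_le_trans zexi re.
Qed.

(** * Minimization of Lipschitz functions on compact sets *)

Definition lip_on (R : realType) n (L : R) (B : set 'rV[R]_n)
    (f : 'rV[R]_n -> R) :=
  forall x y, B x -> B y -> `|f x - f y| <= L * `|x - y|.

Lemma lip_cvg_within (R : realType) n (L : R) (B : set 'rV[R]_n) f x :
  lip_on L B f -> B x -> f y @[y --> within B (nbhs x)] --> f x.
Proof.
move=> fL Bx; apply/cvgrPdist_lt => e e0.
pose M := Num.max L 1.
have M0 : 0 < M by rewrite lt_max ltr01 orbT.
have LM : L <= M by rewrite le_max lexx.
near=> y.
have By : B y by near: y; exact: withinT.
apply: le_lt_trans (fL _ _ Bx By) _.
apply: le_lt_trans (ler_wpM2r (normr_ge0 _) LM) _.
rewrite mulrC -ltr_pdivlMr// distrC; near: y.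
have := near_norm_lt x (divr_gt0 e0 M0); exact: cvg_within.
Unshelve. all: by end_near. Qed.

Lemma cvg_sum_fin (K : numFieldType) (V : normedModType K) (T : Type)
    (F : set_system T) (FF : Filter F) (I : finType) (f : I -> T -> V)
    (l : I -> V) :
  (forall i, f i x @[x --> F] --> l i) ->
  \sum_i f i x @[x --> F] --> \sum_i l i.
Proof. by move=> fl; apply: cvg_big => //; exact: add_continuous. Qed.

Lemma cvg_dot (R : realType) n T (F : set_system T) (FF : Filter F)
    (f g : T -> 'rV[R]_n) (a b : 'rV[R]_n) :
  f @ F --> a -> g @ F --> b -> dot (f x) (g x) @[x --> F] --> dot a b.
Proof.
move=> fa gb; under eq_fun do rewrite dotE.
rewrite dotE; apply: cvg_sum_fin => j; apply: cvgM.
  apply: (@cvg_comp _ _ _ f (fun M : 'rV[R]_n => M 0 j) _ _ _ fa).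
  exact: coord_continuous.
apply: (@cvg_comp _ _ _ g (fun M : 'rV[R]_n => M 0 j) _ _ _ gb).
exact: coord_continuous.
Qed.

Lemma cvg_within_id (R : realType) n (B : set 'rV[R]_n) (x : 'rV[R]_n) :
  y @[y --> within B (nbhs x)] --> x.
Proof. exact: cvg_within. Qed.

Lemma compact_argmin (R : realType) n (B : set 'rV[R]_n) (f : 'rV[R]_n -> R) :
  compact B -> B !=set0 ->
  (forall x, B x -> f y @[y --> within B (nbhs x)] --> f x) ->
  exists c, B c /\ forall y, B y -> f c <= f y.
Proof.
move=> cB B0 fc.
have [|c] := @EVT_min_rV _ _ f B B0 cB.
  by apply/subspace_continuousP.
by rewrite inE => Bc cmin; exists c; split => // y By; apply: cmin; rewrite inE.
Qed.

Lemma compact_norm_bound (R : realType) n (B : set 'rV[R]_n) : compact B ->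
  exists D : R, 0 <= D /\ forall x, B x -> `|x| <= D.
Proof.
move=> /compact_bounded[M [_ MB]]; exists (`|M| + 1); split => [|x Bx].
  by rewrite addr_ge0.
by apply: (MB (`|M| + 1)) => //; rewrite (le_lt_trans (ler_norm M))// ltrDl.
Qed.

(** * Proximal points and Moreau envelopes *)

(** [x] attains the Moreau envelope of [f] with parameter [j] at [y], the
    infimum being restricted to [B]. *)
Definition prox_point (R : realType) n (j : R) (f : 'rV[R]_n -> R)
    (B : set 'rV[R]_n) (y x : 'rV[R]_n) :=
  B x /\ forall x', B x' ->
    f x + j * dot (x - y) (x - y) <= f x' + j * dot (x' - y) (x' - y).

Lemma prox_exists (R : realType) n (j L : R) (f : 'rV[R]_n -> R)
    (B : set 'rV[R]_n) :
  compact B -> B !=set0 -> lip_on L B f ->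
  exists P, forall y, prox_point j f B y (P y).
Proof.
move=> cB B0 fL.
suff H y : exists x, prox_point j f B y x by have [P ?] := choice H; exists P.
apply: (@compact_argmin R n B (fun x => f x + j * dot (x - y) (x - y)) cB B0)
  => x Bx.
apply: cvgD; first exact: (lip_cvg_within fL).
by apply: cvgMr; apply: cvg_dot;
  (apply: cvgB; [exact: cvg_within_id|exact: cvg_cst]).
Qed.

(** Comparing the value at [x] with the value at [y] itself gives
    [j |x - y|^2 <= f y - f x <= L |x - y|].  So proximal points approach [y] at
    rate [1/j], while the subgradients [2 j (y - x)] that they carry stay
    bounded. *)
Lemma prox_dist (R : realType) n (j L : R) (f : 'rV[R]_n -> R)
    (B : set 'rV[R]_n) y x : 0 <= j -> 0 <= L -> lip_on L B f -> B y ->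
  prox_point j f B y x -> j * `|x - y| <= L.
Proof.
move=> j0 L0 fL By [Bx] /(_ _ By); rewrite subrr dot0r mulr0 addr0 => xy.
have [->|xy0] := eqVneq (`|x - y|) 0; first by rewrite mulr0.
have xyp : 0 < `|x - y| by rewrite lt_def xy0 normr_ge0.
rewrite -(ler_pM2r xyp) -mulrA -expr2.
have := ler_wpM2l j0 (sqr_norm_le_dot (x - y)).
have := fL _ _ By Bx => /(le_trans (ler_norm _)).
rewrite (distrC y x); move: xy; lra.
Qed.

Lemma prox_value_ge (R : realType) n (j L : R) (f : 'rV[R]_n -> R)
    (B : set 'rV[R]_n) y x : 0 < j -> 0 <= L -> lip_on L B f -> B y ->
  prox_point j f B y x -> f y - L ^+ 2 / j <= f x + j * dot (x - y) (x - y).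
Proof.
move=> j0 L0 fL By xP; have Bx := xP.1.
have xd : `|y - x| <= L / j.
  by rewrite ler_pdivlMr// mulrC distrC (prox_dist (ltW j0) L0 fL By xP).
have := le_trans (ler_norm _) (fL _ _ By Bx).
have := ler_wpM2l L0 xd.
have : 0 <= j * dot (x - y) (x - y) by rewrite mulr_ge0 ?dot_ge0 ?ltW.
rewrite expr2 -mulrA; lra.
Qed.

(** Optimality of [x] for [f + j |. - y|^2], expanded at [x]: the gradient of
    the quadratic is compensated by a proximal subgradient of [f]. *)
Lemma prox_regular_subgradient (R : realType) n (j : R) (f : 'rV[R]_n -> R)
    (B : set 'rV[R]_n) y x : 0 <= j -> nbhs x B ->
  prox_point j f B y x -> regular_subgradient f x ((2 * j) *: (y - x)).
Proof.
move=> j0 xB [Bx xmin].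
apply: (@regular_subgradient_quadratic _ _ _ _ _ j) => //.
apply: filterS xB => x' /xmin.
have -> : x' - y = (x - y) + (x' - x) by apply/rowP => i; rewrite !mxE; ring.
rewrite (dot_sqrD (x - y)) -[y - x]opprB scalerN dotNl dotZl; lra.
Qed.

(** The proximal point of [y] is a competitor at [y'], so the two values differ
    by at most the variation of the quadratic, which is Lipschitz on a bounded
    set.  This holds for any selection [P] and makes sums of envelopes
    minimizable. *)
Lemma envelope_lip (R : realType) n (j D : R) (f : 'rV[R]_n -> R)
    (B : set 'rV[R]_n) (P : 'rV[R]_n -> 'rV[R]_n) :
  0 <= j -> (forall x, B x -> `|x| <= D) ->
  (forall y, prox_point j f B y (P y)) ->
  lip_on (j * (n%:R * (4 * D))) B
    (fun y => f (P y) + j * dot (P y - y) (P y - y)).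
Proof.
move=> j0 BD PP.
suff H y y' : B y -> B y' ->
    (f (P y') + j * dot (P y' - y') (P y' - y')) -
    (f (P y) + j * dot (P y - y) (P y - y)) <= j * (n%:R * (4 * D)) * `|y' - y|.
  move=> y y' By By'; rewrite ler_norml H// lerNl opprB distrC H//.
move=> By By'.
have [BP _] := PP y; have [_ /(_ _ BP) P'] := PP y'.
have -> : P y - y = (P y - y') + (y' - y) by rewrite addrA subrK.
set u := P y - y' in P' *; set w := y' - y.
have : - (2 * dot u w + dot w w) <= n%:R * (4 * D) * `|w|.
  have -> : 2 * dot u w + dot w w = dot (2 *: u + w) w.
    by rewrite (dotDl (2 *: u)) (dotZl 2).
  rewrite (le_trans (ler_norm _))// normrN (le_trans (norm_dot_le _ _))//.
  rewrite -mulrA ler_wpM2l// ler_wpM2r//.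
  have -> : 2 *: u + w = P y + P y + (- y' + - y).
    by rewrite /u /w scaler_nat mulr2n; apply/rowP => i; rewrite !mxE; ring.
  rewrite (le_trans (ler_normD _ _))//.
  have := ler_normD (P y) (P y); have := ler_normD (- y') (- y).
  rewrite !normrN.
  have := BD _ BP; have := BD _ By; have := BD _ By'; lra.
move=> /(ler_wpM2l j0); rewrite (dot_sqrD u w); move: P'; lra.
Qed.

(** * The sum rule at a minimizer *)

(** Replacing each [g i] by its envelope decouples the sum: at a minimizer [y]
    of the regularized problem, freezing the proximal points [x i] leaves [g0]
    plus a quadratic, which gives a subgradient of [g0] at [y], while each [x i]
    carries a subgradient of [g i].  The subgradients add up exactly, but sit
    at different points.  One extra unit in the quadratic coefficient, [K + 1],
    makes the minimizer [z] strict and forces [y] to be close to [z].  Proximal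
    points exist also for [lam i = 0], so the rule provides a subgradient of
    [g i] even then. *)
Lemma approximate_sum_rule (R : realType) n (T : finType)
    (g0 : 'rV[R]_n -> R) (g : T -> 'rV[R]_n -> R) (lam : T -> R)
    (a z : 'rV[R]_n) (B : set 'rV[R]_n) (K L j : R) :
  compact B -> B z -> 0 <= L -> lip_on L B g0 -> (forall i, lip_on L B (g i)) ->
  (forall i, 0 <= lam i) -> 0 <= K -> 0 < j ->
  (forall y, B y -> g0 z + \sum_i lam i * g i z <=
     g0 y + \sum_i lam i * g i y + dot a (y - z) + K * dot (y - z) (y - z)) ->
  exists (y : 'rV[R]_n) (x : T -> 'rV[R]_n),
    [/\ B y, `|y - z| ^+ 2 <= (\sum_i lam i * L ^+ 2) / j,
        forall i, j * `|x i - y| <= L,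
        forall i, nbhs (x i) B ->
          regular_subgradient (g i) (x i) ((2 * j) *: (y - x i)) &
        nbhs y B -> regular_subgradient g0 y
          (- (\sum_i lam i *: ((2 * j) *: (y - x i)) + a +
              (2 * (K + 1)) *: (y - z)))].
Proof.
move=> cB Bz L0 g0L gL lam0 K0 j0 zmin.
have B0 : B !=set0 by exists z.
have [D [D0 BD]] := compact_norm_bound cB.
have [P PP] := choice (fun i => prox_exists j cB B0 (gL i)).
pose env i y := g i (P i y) + j * dot (P i y - y) (P i y - y).
pose H y := g0 y + \sum_i lam i * env i y + dot a (y - z) +
  (K + 1) * dot (y - z) (y - z).
have [|y [By ymin]] := @compact_argmin R n B H cB B0.
  move=> x Bx; rewrite /H; apply: cvgD; first apply: cvgD; first apply: cvgD.
  - exact: (lip_cvg_within g0L).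
  - apply: cvg_sum_fin => i; apply: cvgMr.
    exact: (lip_cvg_within (envelope_lip (ltW j0) BD (PP i))).
  - apply: cvg_dot; first exact: cvg_cst.
    by apply: cvgB; [exact: cvg_within_id|exact: cvg_cst].
  - by apply: cvgMr; apply: cvg_dot;
      (apply: cvgB; [exact: cvg_within_id|exact: cvg_cst]).
exists y, (fun i => P i y); split => //.
- have env_ge i : g i y - L ^+ 2 / j <= env i y.
    by apply: (prox_value_ge j0 L0 (gL i) By).
  have env_le i : env i z <= g i z.
    by have [_ /(_ _ Bz)] := PP i z; rewrite subrr dot0r mulr0 addr0.
  have s1 : \sum_i lam i * env i z <= \sum_i lam i * g i z.
    by apply: ler_sum => i _; rewrite ler_wpM2l.
  have s2 : \sum_i lam i * g i y - (\sum_i lam i * L ^+ 2) / j <=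
      \sum_i lam i * env i y.
    rewrite mulr_suml -sumrB; apply: ler_sum => i _.
    by rewrite -mulrA -mulrBr ler_wpM2l.
  have := zmin _ By; have := ymin _ Bz; rewrite /H subrr !dot0r.
  have := sqr_norm_le_dot (y - z); lra.
- by move=> i; apply: (prox_dist (ltW j0) L0 (gL i) By).
- by move=> i xB; apply: (prox_regular_subgradient (ltW j0) xB).
- move=> yB.
  apply: (@regular_subgradient_quadratic _ _ _ _ _
    (\sum_i lam i * j + (K + 1))).
    by rewrite addr_ge0 ?addr_ge0// sumr_ge0// => i _; rewrite mulr_ge0// ltW.
  apply: filterS yB => w Bw.
  have env_le i : env i w <= env i y + 2 * j * dot (y - P i y) (w - y) +
      j * dot (w - y) (w - y).
    have [_ /(_ _ (PP i y).1)] := PP i w.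
    rewrite -/(env i w) => /le_trans; apply.
    have -> : P i y - w = (P i y - y) + - (w - y).
      by apply/rowP => k; rewrite !mxE; ring.
    rewrite (dot_sqrD (P i y - y)) /env dotNr (dotNl (w - y)) dotNr.
    rewrite -[y - P i y]opprB dotNl; lra.
  have : \sum_i lam i * env i w <= \sum_i lam i * env i y +
      dot (\sum_i lam i *: ((2 * j) *: (y - P i y))) (w - y) +
      (\sum_i lam i * j) * dot (w - y) (w - y).
    rewrite mulr_suml dot_suml -!big_split/=; apply: ler_sum => i _.
    rewrite (dotZl (lam i)) dotZl; have := ler_wpM2l (lam0 i) (env_le i); lra.
  have := ymin _ Bw; rewrite /H.
  have -> : w - z = (y - z) + (w - y) by apply/rowP => k; rewrite !mxE; ring.
  rewrite (dot_sqrD (y - z)) (dotDr (y - z)).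
  rewrite dotNl (dotDl (_ + a)) (dotDl _ a) dotZl; lra.
Qed.

Lemma norm_le_compact (R : realType) n (x : 'rV[R]_n) (D : R) :
  compact [set v : 'rV[R]_n | `|x - v| <= D].
Proof.
apply: bounded_closed_compact; last exact: closed_closed_ball_.
exists (`|x| + D); split => [|M DM v /= xv]; first exact: num_real.
rewrite (le_trans _ (ltW DM))// -[v](subKr x) (le_trans (ler_normB _ _))//.
by rewrite lerD2l.
Qed.

Lemma ultra_fmap (S T : Type) (f : S -> T) (U : set_system S) :
  UltraFilter U -> UltraFilter (f @ U).
Proof.
move=> UU; split; first exact: fmap_proper_filter.
move=> G GG sUG; apply/seteqP; split => [A GA|]; last exact: sUG.
have [|nA] := in_ultra_setVsetC (f @^-1` A) UU; first by [].
have /filter_ex[x []//] : G (A `&` ~` A).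
by apply: filterI => //; exact: sUG.
Qed.

(** An ultrafilter replaces successive extraction of subsequences, one for each
    function of the family: along it all bounded sequences converge at once. *)
Lemma ultra_bounded_cvg (R : realType) n (U : set_system nat) (D : R)
    (u : nat -> 'rV[R]_n) : UltraFilter U -> (forall k, `|u k| <= D) ->
  exists v : 'rV[R]_n, u @ U --> v.
Proof.
move=> UU uD.
have := @norm_le_compact R n 0 D.
rewrite compact_ultra /= => /(_ (fmap u U : set_system 'rV[R]_n) _)[||v].
- exact: ultra_fmap.
- by apply: (@filterE _ U) => k; rewrite /= sub0r normrN; exact: uD.
- by move=> [_ uv]; exists v.
Qed.

(** The exact rule, with all subgradients at [z], is the limit of
    [approximate_sum_rule] as [j] tends to infinity; boundedness of the
    subgradients comes from the Lipschitz constant, see [prox_dist]. *)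
Lemma weighted_sum_rule (R : realType) n (T : finType)
    (g0 : 'rV[R]_n -> R) (g : T -> 'rV[R]_n -> R) (lam : T -> R)
    (a z : 'rV[R]_n) (B : set 'rV[R]_n) (K L : R) :
  compact B -> nbhs z B -> 0 <= L ->
  lip_on L B g0 -> (forall i, lip_on L B (g i)) ->
  (forall i, 0 <= lam i) -> 0 <= K ->
  (forall y, B y -> g0 z + \sum_i lam i * g i z <=
     g0 y + \sum_i lam i * g i y + dot a (y - z) + K * dot (y - z) (y - z)) ->
  exists eta : T -> 'rV[R]_n,
    (forall i, limiting_subgradient (g i) z (eta i)) /\
    limiting_subgradient g0 z (- (\sum_i lam i *: eta i + a)).
Proof.
move=> cB zB L0 g0L gL lam0 K0 zmin.
have Bz := nbhs_singleton zB.
have /choice[y /choice[x yx]] := fun k : nat =>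
  approximate_sum_rule cB Bz L0 g0L gL lam0 K0 (ltr0Sn R k) zmin.
have yz : y @ \oo --> z.
  by apply: (@cvg_nat_rate _ _ _ _ _ 1) => k; have [_ + _ _ _] := yx k; exact.
have xy i : (fun k => x k i - y k) @ \oo --> (0 : 'rV[R]_n).
  apply: (@cvg_nat_rate _ _ _ _ L 0) => k.
  rewrite subr0 expr1 ler_pdivlMr// mulrC.
  by have [_ _ + _ _] := yx k; exact.
have xz i : x^~ i @ \oo --> z.
  rewrite (_ : x^~ i = fun k => (x k i - y k) + y k).
    by rewrite -[z]add0r; exact: cvgD.
  by apply/funext => k; rewrite subrK.
have [U [UU ooU]] := @ultraFilterLemma nat \oo _.
have toU (u : nat -> 'rV[R]_n) (v : 'rV[R]_n) : u @ \oo --> v -> u @ U --> v.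
  by move=> uv A /uv; exact: ooU.
pose ze i k : 'rV[R]_n := (2 * k.+1%:R) *: (y k - x k i).
have ze_le i k : `|ze i k| <= 2 * L.
  have [_ _ /(_ i) + _ _] := yx k.
  by rewrite normrZ ger0_norm// -mulrA distrC ler_pM2l.
have [eta zeta] := choice (fun i => ultra_bounded_cvg UU (ze_le i)).
(* The subgradient clauses of [approximate_sum_rule] hold only at interior
   points of [B]; all the points involved tend to [z], which is interior. *)
have zBB : \forall w \near z, nbhs w B by exact: nbhs_interior.
exists eta; split => [i|].
  apply: (@limiting_subgradient_filter R n (g i) z _ _ U _ (x^~ i) (ze i)).
  - exact: toU.
  - exact: zeta.
  - apply: (@filterS _ U _ _ _ _ (toU _ _ (xz i) _ zBB)) => k xkB.
    by have [_ _ _ + _] := yx k; exact.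
apply: (@limiting_subgradient_filter R n g0 z _ _ U _ y
  (fun k => - (\sum_i lam i *: ze i k + a + (2 * (K + 1)) *: (y k - z)))).
- exact: toU.
- apply: cvgN; rewrite -[X in _ --> X]addr0; apply: cvgD.
    apply: cvgD; last exact: cvg_cst.
    by apply: cvg_sum_fin => i; exact: cvgZr.
  rewrite -[X in _ --> X](scaler0 _ (2 * (K + 1))) -(subrr z); apply: cvgZr.
  by apply: cvgB; [exact: toU|exact: cvg_cst].
- apply: (@filterS _ U _ _ _ _ (toU _ _ yz _ zBB)) => k ykB.
  by have [_ _ _ _ +] := yx k; exact.
Qed.

(** * The quadratic penalty *)

(** Kept signed for equality constraints, so that its square is a
    continuously differentiable function of [t] in both cases. *)
Definition violation (R : realType) (ineq : bool) (t : R) : R :=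
  if ineq then Num.max 0 t else t.

Definition flip_sign (R : realType) (s : bool) (t : R) : R :=
  if s then - t else t.

Lemma violation_lip (R : realType) ineq (t t' : R) :
  `|violation ineq t - violation ineq t'| <= `|t - t'|.
Proof.
rewrite /violation; case: ineq => //; rewrite ler_norml.
have := ler_norm (t - t'); have := ler_norm (t' - t); rewrite distrC.
by case: (leP 0 t); case: (leP 0 t') => ? ? ? ?; apply/andP; split; lra.
Qed.

(** The derivative of [violation ineq t ^+ 2] is 2-Lipschitz, whence a quadratic
    upper bound.  Its slope is written as a nonnegative multiplier times a
    sign: for an equality constraint with negative value the multiplier bears on
    the opposite function. *)
Lemma violation_sqr_le (R : realType) (ineq : bool) (t0 t : R) :
  let s := ~~ ineq && (t0 < 0) in
  violation ineq t ^+ 2 <= violation ineq t0 ^+ 2 +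
    2 * `|violation ineq t0| * (flip_sign s t - flip_sign s t0) + (t - t0) ^+ 2.
Proof.
rewrite /violation /flip_sign; case: ineq => /=.
  case: (leP 0 t0); case: (leP 0 t) => h h0.
  - by rewrite ger0_norm//; lra.
  - by rewrite ger0_norm//; have := sqr_ge0 t; lra.
  - rewrite normr0; have := mulr_ge0_le0 h (ltW h0); have := sqr_ge0 t0; lra.
  - rewrite normr0; have := sqr_ge0 (t - t0); lra.
case: (ltP t0 0) => h0; first by rewrite ltr0_norm//; lra.
by rewrite ger0_norm//; lra.
Qed.

Lemma lip_cvg (R : realType) n (L : R) (B : set 'rV[R]_n) f T (F : set_system T)
    (FF : Filter F) (u : T -> 'rV[R]_n) (x : 'rV[R]_n) :
  lip_on L B f -> B x -> (forall k, B (u k)) -> u @ F --> x ->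
  f (u k) @[k --> F] --> f x.
Proof.
move=> fL Bx Bu ux; apply: cvg_comp (lip_cvg_within fL Bx) => A /= xA.
by apply: (@filterS _ F _ _ _ _ (ux _ xA)) => k /=; apply; exact: Bu.
Qed.

Section penalty.
Variables (R : realType) (n : nat) (T : finType) (I : pred T).
Variables (g0 : 'rV[R]_n -> R) (g : T -> 'rV[R]_n -> R).
Variables (zb : 'rV[R]_n) (B : set 'rV[R]_n) (L : R).
Hypotheses (cB : compact B) (zbB : nbhs zb B) (L0 : 0 <= L).
Hypotheses (g0L : lip_on L B g0) (gL : forall i, lip_on L B (g i)).
Hypothesis zb_feasible : forall i, violation (I i) (g i zb) = 0.
Hypothesis zb_min : forall x, B x -> (forall i, violation (I i) (g i x) = 0) ->
  g0 zb <= g0 x.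

Let pen k x := g0 x + k * \sum_i violation (I i) (g i x) ^+ 2 +
  dot (x - zb) (x - zb).

Lemma viol_lip i : lip_on L B (fun x => violation (I i) (g i x)).
Proof.
by move=> x y Bx By; apply: le_trans (violation_lip _ _ _) _; exact: gL.
Qed.

(** Along an ultrafilter the minimizers for the parameters 1, 2, ... converge to
    some [zs] in [B].  Comparison with the value at [zb] bounds the squared
    violation by [O(1/k)], so [zs] is feasible; optimality of [zb] and the term
    [dot (x - zb) (x - zb)] of the penalty then force [zs = zb]. *)
Lemma penalty_minimizers (e : R) : 0 < e -> exists k z,
  [/\ 0 < k, B z, `|z - zb| < e & forall x, B x -> pen k z <= pen k x].
Proof.
move=> e0.
have Bzb := nbhs_singleton zbB.
have /choice[z zP] : forall k : nat, exists z,
    B z /\ forall x, B x -> pen k.+1%:R z <= pen k.+1%:R x.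
  move=> k; apply: compact_argmin => //; first by exists zb.
  move=> x Bx; rewrite /pen; apply: cvgD; first apply: cvgD.
  - exact: lip_cvg_within g0L Bx.
  - apply: cvgMr; apply: cvg_sum_fin => i.
    by apply: (@cvgM _ _ _ _ (fun y => violation (I i) (g i y))
        (fun y => violation (I i) (g i y)));
      exact: lip_cvg_within (viol_lip i) Bx.
  - by apply: cvg_dot; (apply: cvgB; [exact: cvg_within_id|exact: cvg_cst]).
have Bz k : B (z k) by have [] := zP k.
have zle k : pen k.+1%:R (z k) <= g0 zb.
  have [_ /(_ _ Bzb)] := zP k.
  rewrite {2}/pen subrr dot0r big1 ?mulr0 ?addr0// => i _.
  by rewrite zb_feasible expr2 mul0r.
have [D [D0 BD]] := compact_norm_bound cB.
have [U [UU ooU]] := @ultraFilterLemma nat \oo _.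
have [zs [Bzs zzs]] : exists zs : 'rV[R]_n, B zs /\ z @ U --> zs.
  move: cB; rewrite compact_ultra /=.
  move=> /(_ (fmap z U : set_system 'rV[R]_n) _)[||zs].
  - exact: ultra_fmap.
  - by apply: (@filterE _ U) => k; exact: Bz.
  - by move=> [? ?]; exists zs.
have sum_ge0 k : 0 <= \sum_i violation (I i) (g i (z k)) ^+ 2.
  by apply: sumr_ge0 => i _; exact: sqr_ge0.
have zs_feas i : violation (I i) (g i zs) = 0.
  apply/eqP; rewrite -sqrf_eq0 eq_le sqr_ge0 andbT.
  have c1 : (violation (I i) (g i (z k)) ^+ 2) @[k --> U] -->
      violation (I i) (g i zs) ^+ 2.
    by apply: (@cvgM _ _ _ _ (fun k => violation (I i) (g i (z k)))
        (fun k => violation (I i) (g i (z k))));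
      exact: lip_cvg (viol_lip i) Bzs Bz zzs.
  have c2 : ((L * (2 * D)) / k.+1%:R) @[k --> U] --> (0 : R).
    have : ((L * (2 * D)) / k.+1%:R) @[k --> \oo] --> (L * (2 * D)) * 0.
      by apply: cvgMr; exact: cvg_harmonic.
    by rewrite mulr0 => h A /h; exact: ooU.
  apply: ler_cvg_to c1 c2 _; apply: filterE => k /=.
  rewrite ler_pdivlMr// mulrC.
  have viol1 : violation (I i) (g i (z k)) ^+ 2 <=
      \sum_i violation (I i) (g i (z k)) ^+ 2.
    by rewrite (bigD1 i)//= lerDl sumr_ge0// => j _; exact: sqr_ge0.
  have := ler_wpM2l (ler0n R k.+1) viol1.
  have := zle k; rewrite /pen; have := dot_ge0 (z k - zb).
  have := le_trans (ler_norm _) (g0L Bzb (Bz k)).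
  have : L * `|zb - z k| <= L * (2 * D).
    rewrite ler_wpM2l// (le_trans (ler_normB _ _))//.
    by have := BD _ Bzb; have := BD _ (Bz k); lra.
  lra.
have zszb : zs = zb.
  have c1 : g0 (z k) + dot (z k - zb) (z k - zb) @[k --> U] -->
      g0 zs + dot (zs - zb) (zs - zb).
    apply: cvgD; first exact: lip_cvg g0L Bzs Bz zzs.
    by apply: cvg_dot; (apply: cvgB; [exact: zzs|exact: cvg_cst]).
  have : g0 zs + dot (zs - zb) (zs - zb) <= g0 zb.
    apply: ler_cvg_to c1 (cvg_cst _) _; apply: filterE => k /=.
    have := mulr_ge0 (ler0n R k.+1) (sum_ge0 k).
    by have := zle k; rewrite /pen; lra.
  have := zb_min Bzs zs_feas; have := sqr_norm_le_dot (zs - zb) => h1 h2 h3.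
  apply/eqP; rewrite -subr_eq0 -normr_eq0 -sqrf_eq0 eq_le sqr_ge0 andbT; lra.
have /filter_ex[k zk] : \forall k \near U, `|zb - z k| < e.
  by move: zzs; rewrite zszb => /cvgrPdist_lt; exact.
by exists k.+1%:R, (z k); split => //; [rewrite distrC|have [] := zP k].
Qed.

(** By [violation_sqr_le], a minimizer [z] of the penalty also minimizes, up to
    a quadratic centred at [z], the function obtained by replacing each squared
    violation by its linearization in [g i]; the Lipschitz bound on [g i] turns
    [(g i x - g i z)^2] into such a quadratic.  The slopes are the multipliers
    of the sum rule, so that no chain rule for the squares is needed. *)
Lemma penalty_stationary (e : R) : 0 < e ->
  exists (z : 'rV[R]_n) (lam : T -> R) (s : T -> bool) (eta0 : 'rV[R]_n)
    (eta : T -> 'rV[R]_n),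
  [/\ `|z - zb| < e /\ `|eta0 + \sum_i lam i *: eta i| < e,
      limiting_subgradient g0 z eta0,
      forall i,
        limiting_subgradient (fun x => flip_sign (s i) (g i x)) z (eta i),
      forall i, I i -> s i = false &
      forall i, 0 <= lam i /\ (I i -> g i zb < 0 -> lam i = 0)].
Proof.
move=> e0.
have Bzb := nbhs_singleton zbB.
(* The last condition makes the multipliers of inactive constraints vanish. *)
have good : \forall x \near zb, [/\ nbhs (x : 'rV[R]_n) B, `|x - zb| < e / 2 &
    forall i, I i -> g i zb < 0 -> g i x < 0].
  near=> x; split; [by near: x; exact: nbhs_interior| |].
    by near: x; apply: near_norm_lt; rewrite divr_gt0.
  near: x; apply: filter_forall => i.
  case: (ltP (g i zb) 0) => [gi0|]; last by move=> _; near=> x.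
  have L1 : 0 < L + 1 by rewrite ltr_wpDl.
  near=> x => _ _.
  have Bx : B x by near: x.
  have : `|x - zb| < - g i zb / (L + 1).
    by near: x; apply: near_norm_lt; rewrite divr_gt0// oppr_gt0.
  rewrite ltr_pdivlMr//.
  have := le_trans (ler_norm _) (gL i Bx Bzb).
  have := normr_ge0 (x - zb); lra.
have /nbhs_ballP[r /= r0] := good; rewrite -ball_normE => rgood.
have [k [z [k0 Bz zzb zmin]]] := penalty_minimizers r0.
have [zB zbe gneg] : [/\ nbhs z B, `|z - zb| < e / 2 &
    forall i, I i -> g i zb < 0 -> g i z < 0].
  by apply: rgood => /=; rewrite distrC.
pose s i := ~~ I i && (g i z < 0).
pose lam i := 2 * k * `|violation (I i) (g i z)|.
have lam0 i : 0 <= lam i by rewrite !mulr_ge0// ltW.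
have [|||eta [etaP eta0P]] := @weighted_sum_rule R n T g0
    (fun i x => flip_sign (s i) (g i x)) lam (2 *: (z - zb)) z B
    (1 + \sum_(i : T) k * L ^+ 2) L cB zB L0 g0L _ lam0.
- move=> i x y Bx By; rewrite /flip_sign; case: (s i); last exact: gL.
  by rewrite -opprD normrN; exact: gL.
- by rewrite addr_ge0// sumr_ge0// => i _; rewrite mulr_ge0 ?sqr_ge0// ltW.
- move=> x Bx.
  have term i :
      k * violation (I i) (g i x) ^+ 2 + lam i * flip_sign (s i) (g i z) <=
      k * violation (I i) (g i z) ^+ 2 + lam i * flip_sign (s i) (g i x) +
      k * L ^+ 2 * dot (x - z) (x - z).
    have glip : (g i x - g i z) ^+ 2 <= L ^+ 2 * dot (x - z) (x - z).
      apply: le_trans (ler_wpM2l (sqr_ge0 L) (sqr_norm_le_dot (x - z))).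
      rewrite -exprMn -real_normK ?num_real// ler_sqr ?nnegrE ?mulr_ge0//.
      exact: gL.
    have := ler_wpM2l (ltW k0) (violation_sqr_le (I i) (g i z) (g i x)).
    have := ler_wpM2l (ltW k0) glip.
    rewrite /= -/(s i) /lam; lra.
  have := ler_sum (index_enum T) (P := xpredT) (fun i _ => term i).
  rewrite !big_split/= -mulr_suml.
  have := zmin _ Bx; rewrite /pen.
  have -> : x - zb = (z - zb) + (x - z) by apply/rowP => i; rewrite !mxE; ring.
  rewrite (dot_sqrD (z - zb)) dotZl -!mulr_sumr; lra.
exists z, lam, s, (- (\sum_i lam i *: eta i + 2 *: (z - zb))), eta; split => //.
- split; first by rewrite (lt_trans zbe)// ltr_pdivrMr// ltr_pMr// ltr1n.
  rewrite opprD addrAC addNr add0r normrN normrZ ger0_norm//; lra.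
- by move=> i Ii; rewrite /s Ii.
- move=> i; split=> // Ii gi; rewrite /lam /violation Ii.
  by rewrite max_l ?normr0 ?mulr0// ltW// gneg.
Unshelve. all: by end_near. Qed.

End penalty.

(** * Asymptotic stationarity *)

Lemma minkowski_sum_mem (R : realType) n (T : finType) (P : pred T)
    (A : T -> set 'rV[R]_n) (v : T -> 'rV[R]_n) :
  (forall i, P i -> A i (v i)) ->
  (\big[@minkowski_add R n/[set 0]]_(i | P i) A i) (\sum_(i | P i) v i).
Proof.
move=> Av; apply: (big_ind2 (fun (S : set 'rV[R]_n) w => S w)) => //.
by move=> S w S' w' Sw S'w'; exists w => //; exists w'.
Qed.

Lemma lipschitz_nearN (R : realType) n (phi : 'rV[R]_n -> \bar R) z :
  lipschitz_near phi z -> lipschitz_near (fun x => (- phi x)%E) z.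
Proof.
move=> [U [zU Ufin [M [Mr MU]]]]; exists U; split => //.
  by move=> x /Ufin; rewrite fin_numN.
exists M; split => // k Mk x Ux /=.
by rewrite !fineN -opprD normrN; exact: (MU _ Mk).
Qed.

Lemma common_lipschitz_ball (R : realType) n (T : finType)
    (phi0 : 'rV[R]_n -> \bar R) (phi : T -> 'rV[R]_n -> \bar R)
    (zb : 'rV[R]_n) (A : set 'rV[R]_n) :
  nbhs zb A -> lipschitz_near phi0 zb ->
  (forall i, lipschitz_near (phi i) zb) ->
  exists (B : set 'rV[R]_n) (L : R),
  [/\ [/\ compact B, nbhs zb B, B `<=` A & 0 <= L],
      forall x, B x -> phi0 x \is a fin_num,
      forall i x, B x -> phi i x \is a fin_num,
      lip_on L B (fun x => fine (phi0 x)) &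
      forall i, lip_on L B (fun x => fine (phi i x))].
Proof.
move=> zbA lip0 lipi.
have [U0 [L0 [zbU0 L0_ge0 U0fin U0lip]]] := lipschitz_nearP lip0.
have /choice[U /choice[L UL]] := fun i => lipschitz_nearP (lipi i).
have : nbhs zb [set x | [/\ A x, U0 x & forall i, U i x]].
  near=> x; split; [by near: x|by near: x|].
  by near: x; apply: filter_forall => i; have [] := UL i.
move=> /nbhs_ballP[r /= r0]; rewrite -ball_normE => rU.
pose B := [set x : 'rV[R]_n | `|zb - x| <= r / 2].
have BU x : B x -> [/\ A x, U0 x & forall i, U i x].
  move=> /= Bx; apply: rU; rewrite /= (le_lt_trans Bx)//.
  by rewrite ltr_pdivrMr// ltr_pMr// ltr1n.
have L_ge0 i : 0 <= L i by have [] := UL i.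
have Lle i : L i <= L0 + \sum_i L i.
  by rewrite (bigD1 i)//= addrCA lerDl addr_ge0// sumr_ge0.
exists B, (L0 + \sum_i L i); split.
- split; first exact: norm_le_compact.
  + near=> x; rewrite /B /= distrC ltW//; near: x.
    by apply: near_norm_lt; rewrite divr_gt0.
  + by move=> x /BU[].
  + by rewrite addr_ge0// sumr_ge0.
- by move=> x /BU[_ /U0fin].
- by move=> i x /BU[_ _ /(_ i)]; have [_ _ + _] := UL i; apply.
- move=> x y /BU[_ Ux _] /BU[_ Uy _]; apply: le_trans (U0lip _ _ Ux Uy) _.
  by rewrite ler_wpM2r// lerDl sumr_ge0.
- move=> i x y /BU[_ _ /(_ i) Ux] /BU[_ _ /(_ i) Uy].
  have [_ _ _ Ulip] := UL i; apply: le_trans (Ulip _ _ Ux Uy) _.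
  by rewrite ler_wpM2r.
Unshelve. all: by end_near. Qed.

Lemma violation_eq0 (R : realType) b (t : R) :
  (violation b t == 0) = if b then t <= 0 else t == 0.
Proof. by rewrite /violation; case: b => //; rewrite eq_maxl. Qed.

Theorem theorem3p4 (R : realType) (n p q : nat)
    (phi0 : 'rV[R]_n -> \bar R) (phi : 'I_(p + q) -> 'rV[R]_n -> \bar R)
    (zb : 'rV[R]_n)
    (zb_feasible : feasible phi zb)
    (phi0_lipschitz : \forall z \near zb, lipschitz_near phi0 z)
    (phi_lipschitz : forall i : 'I_(p + q),
      \forall z \near zb, lipschitz_near (phi i) z) :
  local_minimizer phi0 phi zb -> asymptotically_stationary phi0 phi zb.
Proof.
move=> [_ zb_min]; split => //.
have lipall : \forall z \near zb,
    lipschitz_near phi0 z /\ forall i, lipschitz_near (phi i) z.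
  near=> z; split; first by near: z.
  by near: z; apply: filter_forall => i; exact: phi_lipschitz.
have [lip0 lipi] := nbhs_singleton lipall.
have [B [L [[cB zbB BA L0] fin0 fini g0L gL]]] :=
  common_lipschitz_ball (filterI lipall zb_min) lip0 lipi.
have Bzb := nbhs_singleton zbB.
have feasE x : B x -> feasible phi x <->
    forall i : 'I_(p + q), violation (i < p)%N (fine (phi i x)) = 0.
  move=> Bx; split => [[xI xJ] i|xv].
    apply/eqP; rewrite violation_eq0; case: ltnP => ip.
      by rewrite -lee_fin fineK ?fini ?xI.
    by rewrite xJ.
  split=> i ip; have /eqP := xv i; rewrite violation_eq0.
    by rewrite ip -lee_fin fineK ?fini.
  by rewrite ltnNge ip /= => /eqP h; rewrite -[phi i x]fineK ?fini// h.
have zb_viol := (feasE _ Bzb).1 zb_feasible.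
have zb_rmin x : B x ->
    (forall i : 'I_(p + q), violation (i < p)%N (fine (phi i x)) = 0) ->
    fine (phi0 zb) <= fine (phi0 x).
  move=> Bx /(feasE _ Bx) xfeas; have [_ /(_ xfeas)] := BA _ Bx.
  by rewrite -lee_fin !fineK ?fin0.
have /nbhs_ballP[r /= r0] := zbB; rewrite -ball_normE => rB.
have step (k : nat) : exists z eps lam,
    [/\ `|z - zb| < k.+1%:R^-1, `|eps| < k.+1%:R^-1 &
     [/\ stationarity_set phi0 phi z lam eps,
         forall i : 'I_(p + q), (i < p)%N ->
           Order.min (lam 0 i)%:E (- phi i zb)%E = 0%E
       & forall i : 'I_(p + q), (p <= i)%N -> 0 <= lam 0 i]].
  (* [r] keeps [z] in [B], where every [phi i] is finite and Lipschitz nearby,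
     as the definition of the subdifferential requires. *)
  pose e := Num.min r k.+1%:R^-1.
  have e0 : 0 < e by rewrite lt_min r0 invr_gt0/=.
  have er : e <= r by rewrite ge_min lexx.
  have ek : e <= k.+1%:R^-1 by rewrite ge_min lexx orbT.
  have [z [lam [s [eta0 [eta [[zzb eps_lt] eta0P etaP sP lamP]]]]]] :=
    @penalty_stationary R n 'I_(p + q) (fun i => (i < p)%N)
      (fun x => fine (phi0 x)) (fun i x => fine (phi i x))
      zb B L cB zbB L0 g0L gL zb_viol zb_rmin e e0.
  have Bz : B z by apply: rB; rewrite /= distrC (lt_le_trans zzb).
  have [lip0z lipiz] := (BA _ Bz).1.
  have etaS i : (if s i then subdifferential (fun x => (- phi i x)%E) z
      else subdifferential (phi i) z) (eta i).
    have := etaP i; rewrite /flip_sign; case: (s i) => eta_sub.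
      apply: limiting_subgradient_subdifferential; first exact: lipschitz_nearN.
      by under eq_fun do rewrite fineN.
    exact: limiting_subgradient_subdifferential.
  exists z, (eta0 + \sum_i lam i *: eta i), (\row_i lam i); split.
  - exact: lt_le_trans ek.
  - exact: lt_le_trans ek.
  split.
  - rewrite (bigID (fun i : 'I_(p + q) => (i < p)%N))/= addrA.
    under [X in _ + X]eq_bigl do rewrite -leqNgt.
    (* Minkowski sums are nested as (objective + inequalities) + equalities. *)
    exists (eta0 + \sum_(i < p + q | (i < p)%N) lam i *: eta i).
      exists eta0; first exact: limiting_subgradient_subdifferential.
      exists (\sum_(i < p + q | (i < p)%N) lam i *: eta i) => //.
      apply: minkowski_sum_mem => i ip; rewrite mxE; exists (eta i) => //.
      by have := etaS i; rewrite sP.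
    exists (\sum_(i < p + q | (p <= i)%N) lam i *: eta i) => //.
    apply: minkowski_sum_mem => i ip; rewrite mxE; exists (eta i) => //.
    by have := etaS i; case: (s i); [right|left].
  - move=> i ip; rewrite mxE.
    have [lam0 lam_inactive] := lamP i.
    have phi_le0 : fine (phi i zb) <= 0.
      by have /eqP := zb_viol i; rewrite violation_eq0 ip.
    rewrite -[phi i zb]fineK ?fini// -EFinN -EFin_min; congr (_%:E).
    have [phi0'|phi_ge0] := ltP (fine (phi i zb)) 0.
      by rewrite lam_inactive// min_l// oppr_ge0.
    have -> : fine (phi i zb) = 0 by apply/le_anti/andP.
    by rewrite oppr0 min_r.
  - by move=> i _; rewrite mxE; have [] := lamP i.
have /choice[z /choice[eps /choice[lam zP]]] := step.
exists z, eps, lam; split.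
- apply: (@cvg_nat_rate _ _ _ _ 1 0) => k; rewrite expr1 div1r ltW//.
  by have [+ _ _] := zP k.
- apply: (@cvg_nat_rate _ _ _ _ 1 0) => k; rewrite subr0 expr1 div1r ltW//.
  by have [_ + _] := zP k.
- by move=> k; have [] := zP k.
Unshelve. all: by end_near. Qed.
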